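(* Let $W\subset\mathbf{R}^N$, $Z\subset\mathbf{R}^M$, $U\subset\mathbf{R}^n$, $V\subset\mathbf{R}^m$ be nonempty convex compact sets, let $p\in\mathbf{R}^N$, $q\in\mathbf{R}^M$, $S\in\mathbf{R}^{M\times N}$, $D\in\mathbf{R}^{m\times N}$, $A\in\mathbf{R}^{n\times M}$, $R\in\mathbf{R}^{m\times n}$, and let $\psi(w,z)=\langle w,p\rangle+\langle z,q\rangle+\langle z,Sw\rangle$ on $W\times Z$. Assume that functions $\bar{u}(w,z):W\times Z\to U$ and $\bar{v}(w,z):W\times Z\to V$ satisfy, for all $(w,z)\in W\times Z$, $$Dw=R\bar{u}(w,z),\qquad Az=R^T\bar{v}(w,z),\qquad \langle Dw,\bar{v}(w,z)\rangle=\langle z,Sw\rangle.$$ Consider the primal saddle point problem $\min_{u\in U}\max_{v\in V}\phi(u,v)$ with $$\phi(u,v)=\min_{w\in W}\langle w,p+D^Tv\rangle+\max_{z\in Z}\langle z,q+A^Tu\rangle-\langle Ru,v\rangle,$$ with first order information given by the fields $\phi'_u,\phi'_v$ defined in the context via the Linear Minimization Oracles $w_*(\cdot),z_*(\cdot)$ of $W,Z$. Then for the $t$-step execution protocol $$\mathcal{I}_t=\{[u_i;v_i]\in U\times V,\ [\phi'_u(u_i,v_i);-\phi'_v(u_i,v_i)]:1\le i\le t\}$$ and the accuracy certificate $\lambda^t$ generated by any First Order algorithm with accuracy certificates applied to the primal problem, the point $$w^t=\sum_{i=1}^t\lambda^t_i\,w_*(p+D^Tv_i),\qquad z^t=\sum_{i=1}^t\lambda^t_i\,z_*(-q-A^Tu_i)$$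 is a feasible solution to the saddle point problem $\min_{w\in W}\max_{z\in Z}\psi(w,z)$ (i.e. $w^t\in W$, $z^t\in Z$), and its inaccuracy satisfies $$\epsilon_{\rm sad}([w^t;z^t]\,|\,\psi,W,Z)\leq\mathrm{Res}(\mathcal{I}_t,\lambda^t|U\times V).$$
   Context: $[a;b]$ denotes vertical concatenation of vectors. The Linear Minimization Oracles are arbitrary selections $$w_*(\xi)\in\mathop{\mathrm{Argmin}}_{w\in W}\langle w,\xi\rangle,\qquad z_*(\eta)\in\mathop{\mathrm{Argmin}}_{z\in Z}\langle z,\eta\rangle,$$ and $$\phi'_u(u,v)=Az_*(-q-A^Tu)-R^Tv,\qquad \phi'_v(u,v)=Dw_*(p+D^Tv)-Ru,$$ which are a subgradient of $\phi$ in $u$ and a supergradient of $\phi$ in $v$, respectively. A $t$-step accuracy certificate is a vector $\lambda\in\mathbf{R}^t$ with nonnegative entries summing to 1. A First Order algorithm with accuracy certificates, applied to the primal problem, produces points $[u_i;v_i]\in U\times V$, the corresponding protocol $\mathcal{I}_t$ of these points and field values, and an accuracy certificate $\lambda^t$; nothing else about the algorithm is used in the claim. For a protocol $\mathcal{I}_t=\{\omega_i\in\Omega,M_i:1\le i\le t\}$ on a convex compact set $\Omega$, the residual is $\mathrm{Res}(\mathcal{I}_t,\lambda|\Omega)=\max_{\omega\in\Omega}\sum_{i=1}^t\lambda_i\langle M_i,\omega_i-\omega\rangle$. Saddle point residual: $\epsilon_{\rm sad}([w;z]\,|\,\psi,W,Z)=\max_{z'\in Z}\psi(w,z')-\min_{w'\in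 W}\psi(w',z)$. *)

(* Defs.v *)
From HB Require Import structures.
From mathcomp Require Import all_boot all_order all_algebra.
From mathcomp Require Import all_classical all_reals all_analysis.
From mathcomp Require Import lra.
Set Implicit Arguments.
Unset Strict Implicit.
Unset Printing Implicit Defensive.
Import Order.TTheory GRing.Theory Num.Theory.
Import numFieldNormedType.Exports.
Local Open Scope classical_set_scope.
Local Open Scope ring_scope.

Definition dotcv (R : realType) (n : nat) (x y : 'cV[R]_n) : R :=
  \sum_i x i 0 * y i 0.

(* [maxon]/[minon] are extrema that are attained wherever they are used below:
   see [maxon_attained], [minon_attained]. *)
Definition maxon (R : realType) (T : Type) (K : set T) (f : T -> R) : R :=
  sup [set f x | x in K].

Definition minon (R : realType) (T : Type) (K : set T) (f : T -> R) : R :=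
  inf [set f x | x in K].

Definition Argmin (R : realType) (T : Type) (K : set T) (f : T -> R) : set T :=
  [set x | K x /\ forall y, K y -> f x <= f y].

(* A linear minimization oracle of [K]: an arbitrary selection of minimizers. *)
Definition lmo (R : realType) (n : nat) (K : set 'cV[R]_n)
    (o : 'cV[R]_n -> 'cV[R]_n) : Prop :=
  forall xi, Argmin K (fun x => dotcv x xi) (o xi).

Definition prodcv (R : realType) (n m : nat)
    (U : set 'cV[R]_n) (V : set 'cV[R]_m) : set 'cV[R]_(n + m) :=
  [set col_mx u v | u in U & v in V].

Record protocol (R : realType) (d t : nat) := Protocol {
  point : 'I_t -> 'cV[R]_d;
  field_value : 'I_t -> 'cV[R]_d }.

Definition certificate (R : realType) (t : nat) (lam : 'I_t -> R) : Prop :=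
  (forall i, 0 <= lam i) /\ \sum_i lam i = 1.

Definition Res (R : realType) (d t : nat) (I : protocol R d t)
    (lam : 'I_t -> R) (Omega : set 'cV[R]_d) : R :=
  maxon Omega (fun omega =>
    \sum_i lam i * dotcv (field_value I i) (point I i - omega)).

Definition eps_sad (R : realType) (T1 T2 : Type) (w : T1) (z : T2)
    (f : T1 -> T2 -> R) (W : set T1) (Z : set T2) : R :=
  maxon Z (fun z' => f w z') - minon W (fun w' => f w' z).

Definition psi (R : realType) (N M : nat) (p : 'cV[R]_N) (q : 'cV[R]_M)
    (S : 'M[R]_(M, N)) (w : 'cV[R]_N) (z : 'cV[R]_M) : R :=
  dotcv w p + dotcv z q + dotcv z (S *m w).

(* The couplings are D : m x N, A : n x M and Rm : m x n; [Rm] is the matrix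
   usually written R, a name taken here by the field of scalars. *)
Definition phi (R : realType) (N M n m : nat)
    (W : set 'cV[R]_N) (Z : set 'cV[R]_M) (p : 'cV[R]_N) (q : 'cV[R]_M)
    (D : 'M[R]_(m, N)) (A : 'M[R]_(n, M)) (Rm : 'M[R]_(m, n))
    (u : 'cV[R]_n) (v : 'cV[R]_m) : R :=
  minon W (fun w => dotcv w (p + D^T *m v))
  + maxon Z (fun z => dotcv z (q + A^T *m u))
  - dotcv (Rm *m u) v.

(* [zo (- q - A^T u)] minimizes <., - q - A^T u>, hence attains the inner
   maximum of [phi]; see [phi_u_subgradient], [phi_v_supergradient] below. *)
Definition phi_u (R : realType) (M n m : nat) (q : 'cV[R]_M)
    (A : 'M[R]_(n, M)) (Rm : 'M[R]_(m, n)) (zo : 'cV[R]_M -> 'cV[R]_M)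
    (u : 'cV[R]_n) (v : 'cV[R]_m) : 'cV[R]_n :=
  A *m zo (- q - A^T *m u) - Rm^T *m v.

Definition phi_v (R : realType) (N n m : nat) (p : 'cV[R]_N)
    (D : 'M[R]_(m, N)) (Rm : 'M[R]_(m, n)) (wo : 'cV[R]_N -> 'cV[R]_N)
    (u : 'cV[R]_n) (v : 'cV[R]_m) : 'cV[R]_m :=
  D *m wo (p + D^T *m v) - Rm *m u.

(* [phi] is minimized in u and maximized in v, hence the sign of the second
   block of the field. *)
Definition primal_protocol (R : realType) (N M n m t : nat)
    (p : 'cV[R]_N) (q : 'cV[R]_M)
    (D : 'M[R]_(m, N)) (A : 'M[R]_(n, M)) (Rm : 'M[R]_(m, n))
    (wo : 'cV[R]_N -> 'cV[R]_N) (zo : 'cV[R]_M -> 'cV[R]_M)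
    (u : 'I_t -> 'cV[R]_n) (v : 'I_t -> 'cV[R]_m) : protocol R (n + m) t :=
  Protocol (fun i => col_mx (u i) (v i))
           (fun i => col_mx (phi_u q A Rm zo (u i) (v i))
                            (- phi_v p D Rm wo (u i) (v i))).

Lemma maxon_eq (R : realType) (T : Type) (K : set T) (f : T -> R) (x : T) :
  K x -> (forall y, K y -> f y <= f x) -> maxon K f = f x.
Proof.
move=> Kx h; apply/eqP; rewrite eq_le; apply/andP; split.
  by apply: ge_sup; [exists (f x), x | move=> _ [y Ky <-]; exact: h].
by apply: ub_le_sup; [exists (f x) => _ [y Ky <-]; exact: h | exists x].
Qed.

Lemma minon_eq (R : realType) (T : Type) (K : set T) (f : T -> R) (x : T) :
  K x -> (forall y, K y -> f x <= f y) -> minon K f = f x.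
Proof.
move=> Kx h; apply/eqP; rewrite eq_le; apply/andP; split.
  by apply: ge_inf; [exists (f x) => _ [y Ky <-]; exact: h | exists x].
by apply: lb_le_inf; [exists (f x), x | move=> _ [y Ky <-]; exact: h].
Qed.

Lemma maxon_attained (R : realType) (T : topologicalType) (K : set T)
    (f : T -> R) :
  K !=set0 -> compact K -> {within K, continuous f} ->
  exists2 x, Argmin K (- f) x & maxon K f = f x.
Proof.
move=> K0 cK cf; have [x /set_mem Kx h] := compact_EVT_max K0 cK cf.
have {}h y : K y -> f y <= f x by move=> /mem_set; exact: h.
by exists x; [split=> // y /h; rewrite lerN2 | exact: maxon_eq].
Qed.

Lemma minon_attained (R : realType) (T : topologicalType) (K : set T)
    (f : T -> R) :
  K !=set0 -> compact K -> {within K, continuous f} ->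
  exists2 x, Argmin K f x & minon K f = f x.
Proof.
move=> K0 cK cf; have [x /set_mem Kx h] := compact_EVT_min K0 cK cf.
have {}h y : K y -> f x <= f y by move=> /mem_set; exact: h.
by exists x; [split | exact: minon_eq].
Qed.

Section dotcv_theory.
Variables (R : realType) (n : nat).
Implicit Types x y z : 'cV[R]_n.

Lemma dotcvE x y : dotcv x y = (x^T *m y) 0 0.
Proof. by rewrite mxE; apply: eq_bigr => i _; rewrite mxE. Qed.

Lemma dotcvC x y : dotcv x y = dotcv y x.
Proof. by apply: eq_bigr => i _; rewrite mulrC. Qed.

Lemma dotcvDr x y z : dotcv x (y + z) = dotcv x y + dotcv x z.
Proof. by rewrite !dotcvE mulmxDr mxE. Qed.

Lemma dotcvNr x y : dotcv x (- y) = - dotcv x y.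
Proof. by rewrite !dotcvE mulmxN mxE. Qed.

Lemma dotcvBr x y z : dotcv x (y - z) = dotcv x y - dotcv x z.
Proof. by rewrite dotcvDr dotcvNr. Qed.

Lemma dotcvBl x y z : dotcv (x - y) z = dotcv x z - dotcv y z.
Proof. by rewrite dotcvC dotcvBr ![dotcv z _]dotcvC. Qed.

End dotcv_theory.

Lemma dotcv_mulmx (R : realType) (m n : nat)
    (B : 'M[R]_(m, n)) (x : 'cV[R]_n) (y : 'cV[R]_m) :
  dotcv (B *m x) y = dotcv x (B^T *m y).
Proof. by rewrite !dotcvE trmx_mul mulmxA. Qed.

Section primal_fields.
Variables (R : realType) (N M n m : nat).
Variables (W : set 'cV[R]_N) (Z : set 'cV[R]_M) (p : 'cV[R]_N) (q : 'cV[R]_M).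
Variables (D : 'M[R]_(m, N)) (A : 'M[R]_(n, M)) (Rm : 'M[R]_(m, n)).
Variables (wo : 'cV[R]_N -> 'cV[R]_N) (zo : 'cV[R]_M -> 'cV[R]_M).
Hypotheses (wo_lmo : lmo W wo) (zo_lmo : lmo Z zo).

Lemma maxon_lmo xi :
  maxon Z (fun z => dotcv z xi) = dotcv (zo (- xi)) xi.
Proof.
have [Zz h] := zo_lmo (- xi); apply: maxon_eq => // y /h /=.
by rewrite !dotcvNr lerN2.
Qed.

Lemma minon_lmo xi : minon W (fun w => dotcv w xi) = dotcv (wo xi) xi.
Proof. by have [Ww h] := wo_lmo xi; apply: minon_eq. Qed.

Lemma phi_u_subgradient u v u' :
  phi W Z p q D A Rm u v + dotcv (phi_u q A Rm zo u v) (u' - u)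
  <= phi W Z p q D A Rm u' v.
Proof.
rewrite /phi !maxon_lmo /phi_u !opprD.
set z := zo (- q - A^T *m u); set z' := zo (- q - A^T *m u').
have [_ /(_ z)] := zo_lmo (- q - A^T *m u'); rewrite -/z'.
move=> /(_ (proj1 (zo_lmo _))) /=.
rewrite -!opprD !dotcvNr lerN2 dotcvBl !dotcvBr !dotcvDr.
rewrite !dotcv_mulmx trmxK.
rewrite ![dotcv v _]dotcvC !dotcv_mulmx.
lra.
Qed.

Lemma phi_v_supergradient u v v' :
  phi W Z p q D A Rm u v'
  <= phi W Z p q D A Rm u v + dotcv (phi_v p D Rm wo u v) (v' - v).
Proof.
rewrite /phi !minon_lmo /phi_v.
set w := wo (p + D^T *m v); set w' := wo (p + D^T *m v').
have [_ /(_ w)] := wo_lmo (p + D^T *m v'); rewrite -/w'.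
move=> /(_ (proj1 (wo_lmo _))) /=.
rewrite dotcvBl !dotcvBr !dotcvDr !dotcv_mulmx.
lra.
Qed.

End primal_fields.

(* Main.v *)
(* For w in W and z in Z, test the residual at u = ubar(w, z^t) and
   v = vbar(w^t, z). As D w = R u and A z = R^T v, optimality of the two oracles
   bounds the i-th residual term from below by an expression affine in the
   oracle answers w_i, z_i; averaging turns it into psi(w^t, z) - psi(w, z^t),
   because <D w^t, v> = <z, S w^t> and
   <A z^t, u> = <vbar(w, z^t), R u> = <vbar(w, z^t), D w> = <z^t, S w>. *)
Require Import Defs.
From HB Require Import structures.
From mathcomp Require Import all_boot all_order all_algebra.
From mathcomp Require Import all_classical all_reals all_analysis.
From mathcomp Require Import lra.
Import Order.TTheory GRing.Theory Num.Theory.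
Import numFieldNormedType.Exports.
Local Open Scope classical_set_scope.
Local Open Scope ring_scope.

Set Implicit Arguments.
Unset Strict Implicit.

Lemma dotcvNl (R : realType) (n : nat) (x y : 'cV[R]_n) :
  dotcv (- x) y = - dotcv x y.
Proof. by rewrite dotcvC dotcvNr dotcvC. Qed.

Lemma dotcv_suml (R : realType) (n : nat) (I : finType) (a : I -> R)
    (x : I -> 'cV[R]_n) (y : 'cV[R]_n) :
  dotcv (\sum_i a i *: x i) y = \sum_i a i * dotcv (x i) y.
Proof.
rewrite dotcvC dotcvE mulmx_sumr summxE; apply: eq_bigr => i _.
by rewrite -scalemxAr mxE dotcvC dotcvE.
Qed.

Lemma dotcv_col_mx (R : realType) (n m : nat) (a x : 'cV[R]_n)
    (b y : 'cV[R]_m) :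
  dotcv (col_mx a b) (col_mx x y) = dotcv a x + dotcv b y.
Proof. by rewrite !dotcvE tr_col_mx mul_row_col mxE. Qed.

Lemma dotcv_continuous (R : realType) (n : nat) (a : 'cV[R]_n) :
  continuous (dotcv a).
Proof.
apply: continuous_big => [|i _]; first exact: add_continuous.
by move=> x; apply: (@cvgMl_tmp _ _ (nbhs x)); exact: coord_continuous.
Qed.

Lemma compact_dotcv_ub (R : realType) (n : nat) (K : set 'cV[R]_n)
    (a : 'cV[R]_n) :
  K !=set0 -> compact K -> exists c, forall x, K x -> dotcv a x <= c.
Proof.
move=> K0 cK.
have ca : {within K, continuous (dotcv a)}.
  exact/continuous_subspaceT/dotcv_continuous.
have [y _ hy] := compact_EVT_max K0 cK ca.
by exists (dotcv a y) => x /mem_set; exact: hy.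
Qed.

(** The weights are not normalized because the tail of a convex combination no longer has total
    weight 1. Stated as total weight times a point of [K], the claim passes through the induction on
    [r]. *)
Lemma convex_set_sum (R : numFieldType) (E : lmodType R) (K : set E)
    (I : Type) (r : seq I) (a : I -> R) (x : I -> E) :
  K !=set0 -> convex_set K -> (forall i, 0 <= a i) -> (forall i, K (x i)) ->
  exists2 y, K y & \sum_(i <- r) a i *: x i = (\sum_(i <- r) a i) *: y.
Proof.
move=> [y0 Ky0] cK a0 Kx; elim: r => [|i r [y Ky IH]].
  by exists y0; rewrite // !big_nil scale0r.
rewrite !big_cons IH; set s := \sum_(j <- r) a j.
have s0 : 0 <= s by apply: sumr_ge0 => j _; exact: a0.
(* If the total weight vanishes, so do both nonnegative parts, and any point of [K] serves.
   Otherwise [x i] and [y] are merged with the ratio [a i / (a i + s)]. *)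
have [/eqP|d0] := eqVneq (a i + s) 0.
  rewrite paddr_eq0 ?a0// => /andP[/eqP -> /eqP ->].
  by exists y; rewrite // addr0 !scale0r addr0.
have d_ge0 : 0 <= a i + s by rewrite addr_ge0 ?a0.
have k0 : 0 <= a i / (a i + s) by rewrite divr_ge0.
have k1 : a i / (a i + s) <= 1.
  by rewrite ler_pdivrMr ?lt_def ?d0// mul1r lerDl.
have := cK (x i) y (Itv01 k0 k1) (mem_set (Kx i)) (mem_set Ky).
move=> /set_mem Kc; eexists; first exact: Kc.
rewrite /conv/= scalerDr !scalerA /unstable.onem mulrBr mulr1.
by rewrite [_ * (_ / _)]mulrC divfK// addrAC subrr add0r.
Qed.

(** A uniform bound on pointwise gaps passes to the supremum, then to the infimum. Nonemptiness
    keeps [sup] and [inf] away from their default values. *)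
Lemma eps_sad_le (R : realType) (T1 T2 : Type) (w : T1) (z : T2)
    (f : T1 -> T2 -> R) (W : set T1) (Z : set T2) (e : R) :
  W !=set0 -> Z !=set0 ->
  (forall w' z', W w' -> Z z' -> f w z' - f w' z <= e) ->
  eps_sad w z f W Z <= e.
Proof.
move=> [w0 Ww0] [z0 Zz0] h; rewrite /eps_sad lerBlDr.
apply: ge_sup; first by exists (f w z0), z0.
move=> _ [z' Zz' <-]; rewrite -lerBlDl.
apply: lb_le_inf; first by exists (f w0 z), w0.
by move=> _ [w' Ww' <-]; rewrite lerBlDr -lerBlDl h.
Qed.

(** A [sup] dominates a member only when the set is bounded above. The residual is affine in the
    test point, so compactness of [U] and of [V] bounds the two blocks of its linear part [g]
    separately. *)
Lemma Res_ge (R : realType) (n m t : nat) (U : set 'cV[R]_n)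
    (V : set 'cV[R]_m) (I : protocol R (n + m) t) (lam : 'I_t -> R)
    (u : 'cV[R]_n) (v : 'cV[R]_m) :
  compact U -> compact V -> U u -> V v ->
  \sum_i lam i * dotcv (field_value I i) (Defs.point I i - col_mx u v)
  <= Res I lam (prodcv U V).
Proof.
move=> cU cV Uu Vv; apply: ub_le_sup; last first.
  by exists (col_mx u v); first by exists u => //; exists v.
pose g := - \sum_i lam i *: field_value I i.
have U0 : U !=set0 by exists u.
have V0 : V !=set0 by exists v.
have [b hb] := compact_dotcv_ub (usubmx g) U0 cU.
have [c hc] := compact_dotcv_ub (dsubmx g) V0 cV.
exists (\sum_i lam i * dotcv (field_value I i) (Defs.point I i) + (b + c)).
move=> _ [_ [x Ux [y Vy <-]] <-].
under eq_bigr do rewrite dotcvBr mulrBr.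
rewrite sumrB lerD2l -dotcv_suml -dotcvNl -/g -[g]vsubmxK dotcv_col_mx.
by apply: lerD; [exact: hb | exact: hc].
Qed.

(** The terms <R u_i, v_i> cancel, and the couplings turn <R u', v_i> into <w, D^T v_i> and <R u_i,
    v'> into <z, A^T u_i>. What still involves u_i and v_i is <w - w_i, D^T v_i> + <z_i - z, A^T
    u_i>, which optimality of the oracles bounds below by <w_i - w, p> + <z - z_i, q>. *)
Lemma primal_field_ge (R : realType) (N M n m t : nat) (W : set 'cV[R]_N)
    (Z : set 'cV[R]_M) (p : 'cV[R]_N) (q : 'cV[R]_M) (D : 'M[R]_(m, N))
    (A : 'M[R]_(n, M)) (Rm : 'M[R]_(m, n)) (wo : 'cV[R]_N -> 'cV[R]_N)
    (zo : 'cV[R]_M -> 'cV[R]_M) (u : 'I_t -> 'cV[R]_n) (v : 'I_t -> 'cV[R]_m)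
    (w : 'cV[R]_N) (z : 'cV[R]_M) (u' : 'cV[R]_n) (v' : 'cV[R]_m) (i : 'I_t) :
  lmo W wo -> lmo Z zo -> W w -> Z z ->
  D *m w = Rm *m u' -> A *m z = Rm^T *m v' ->
  dotcv (wo (p + D^T *m v i)) (p + D^T *m v')
  - dotcv (zo (- q - A^T *m u i)) (q + A^T *m u')
  + (dotcv z q - dotcv w p)
  <= dotcv (field_value (primal_protocol p q D A Rm wo zo u v) i)
       (Defs.point (primal_protocol p q D A Rm wo zo u v) i - col_mx u' v').
Proof.
move=> wo_lmo zo_lmo Ww Zz Dw Az /=.
have [_ /(_ w Ww)/=] := wo_lmo (p + D^T *m v i).
have [_ /(_ z Zz)/=] := zo_lmo (- q - A^T *m u i).
rewrite /phi_u /phi_v opp_col_mx add_col_mx dotcv_col_mx.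
set wi := wo _; set zi := zo _.
have Dwv : dotcv w (D^T *m v i) = dotcv (v i) (Rm *m u').
  by rewrite -dotcv_mulmx Dw dotcvC.
have Azu : dotcv z (A^T *m u i) = dotcv v' (Rm *m u i).
  by rewrite -dotcv_mulmx Az dotcv_mulmx trmxK.
rewrite !(dotcvBl, dotcvBr, dotcvDr, dotcvNr, dotcvNl) !dotcv_mulmx trmxK.
rewrite Dwv Azu ![dotcv (u i) (_ *m _)]dotcvC !dotcv_mulmx trmxK.
lra.
Qed.

Unset Implicit Arguments.
Set Strict Implicit.

Theorem proposition3 (R : realType) (N M n m : nat)
  (W : set 'cV[R]_N) (Z : set 'cV[R]_M) (U : set 'cV[R]_n) (V : set 'cV[R]_m)
  (W0 : W !=set0) (Wconv : convex_set W) (Wcomp : compact W)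
  (Z0 : Z !=set0) (Zconv : convex_set Z) (Zcomp : compact Z)
  (U0 : U !=set0) (Uconv : convex_set U) (Ucomp : compact U)
  (V0 : V !=set0) (Vconv : convex_set V) (Vcomp : compact V)
  (p : 'cV[R]_N) (q : 'cV[R]_M) (S : 'M[R]_(M, N))
  (D : 'M[R]_(m, N)) (A : 'M[R]_(n, M)) (Rm : 'M[R]_(m, n))
  (ubar : 'cV[R]_N -> 'cV[R]_M -> 'cV[R]_n)
  (vbar : 'cV[R]_N -> 'cV[R]_M -> 'cV[R]_m)
  (ubarU : forall w z, W w -> Z z -> U (ubar w z))
  (vbarV : forall w z, W w -> Z z -> V (vbar w z))
  (HD : forall w z, W w -> Z z -> D *m w = Rm *m ubar w z)
  (HA : forall w z, W w -> Z z -> A *m z = Rm^T *m vbar w z)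
  (HS : forall w z, W w -> Z z ->
     dotcv (D *m w) (vbar w z) = dotcv z (S *m w))
  (wo : 'cV[R]_N -> 'cV[R]_N) (zo : 'cV[R]_M -> 'cV[R]_M)
  (wo_lmo : lmo W wo) (zo_lmo : lmo Z zo)
  (t : nat) (u : 'I_t -> 'cV[R]_n) (v : 'I_t -> 'cV[R]_m)
  (uU : forall i, U (u i)) (vV : forall i, V (v i))
  (lam : 'I_t -> R) (lam_cert : certificate lam) :
  let wt := \sum_i lam i *: wo (p + D^T *m v i) in
  let zt := \sum_i lam i *: zo (- q - A^T *m u i) in
  [/\ W wt, Z zt &
      eps_sad wt zt (psi p q S) W Z
      <= Res (primal_protocol p q D A Rm wo zo u v) lam (prodcv U V)].
Proof.
have [lam0 lam1] := lam_cert.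
have feasible k (K : set 'cV[R]_k) (x : 'I_t -> 'cV[R]_k) :
    K !=set0 -> convex_set K -> (forall i, K (x i)) ->
    K (\sum_i lam i *: x i).
  move=> K0 cK Kx.
  have [y Ky ->] := convex_set_sum (index_enum 'I_t) K0 cK lam0 Kx.
  by rewrite lam1 scale1r.
move=> wt zt.
(* Feasibility comes first: [ubar] and [vbar] are evaluated below at pairs containing [zt] or [wt],
   and their properties are assumed only on W x Z. *)
have Wwt : W wt by apply: feasible => // i; exact: (wo_lmo _).1.
have Zzt : Z zt by apply: feasible => // i; exact: (zo_lmo _).1.
split=> //; apply: eps_sad_le => // w z Ww Zz.
have DwtS : dotcv wt (D^T *m vbar wt z) = dotcv z (S *m wt).
  by rewrite -dotcv_mulmx HS.
have AztS : dotcv zt (A^T *m ubar w zt) = dotcv zt (S *m w).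
  by rewrite -HS// -dotcv_mulmx (HA w)// dotcv_mulmx trmxK -(HD w)// dotcvC.
have Uu := ubarU _ _ Ww Zzt; have Vv := vbarV _ _ Wwt Zz.
apply: le_trans _ (Res_ge _ lam Ucomp Vcomp Uu Vv).
(* The oracle answers enter linearly and average to [wt] and [zt]; the constant
   [dotcv z q - dotcv w p] survives unchanged since the weights sum to 1. *)
have -> : psi p q S wt z - psi p q S w zt =
    \sum_i lam i * (dotcv (wo (p + D^T *m v i)) (p + D^T *m vbar wt z)
      - dotcv (zo (- q - A^T *m u i)) (q + A^T *m ubar w zt)
      + (dotcv z q - dotcv w p)).
  under eq_bigr do rewrite mulrDr mulrBr.
  rewrite big_split sumrB/= -!dotcv_suml -mulr_suml lam1 mul1r -/wt -/zt.
  rewrite !dotcvDr DwtS AztS /psi; lra.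
apply: ler_sum => i _; apply: ler_wpM2l => //.
apply: (primal_field_ge _ _ _ _ _ wo_lmo zo_lmo Ww Zz); first exact: HD.
exact: HA.
Qed.
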